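(* For every integer $\lambda$ set $a(\lambda)=\frac{5\lambda^2-\lambda}{2}$, and for every integer $n\ge -1$ define the polynomial \[ P(n)=\sum_{-\left\lfloor \frac{n}{5}\right\rfloor\le\lambda\le\left\lfloor\frac{n+1}{5}\right\rfloor}(-1)^\lambda x^{a(\lambda)}\genfrac{[}{]}{0pt}{}{n}{\left\lfloor\frac{n+5\lambda}{2}\right\rfloor}, \] where $\lambda$ ranges over integers. Then $P(-1)=0$, $P(0)=1$, and for all integers $n\ge 1$, \[ P(n)=P(n-1)+x^{n-1}P(n-2). \]
   Context: Here $x$ is an indeterminate. For integers $n,k$, the Gaussian binomial coefficient is \[ \genfrac{[}{]}{0pt}{}{n}{k}=\frac{(x^n-1)(x^{n-1}-1)\cdots(x^{n-k+1}-1)}{(x-1)(x^2-1)\cdots(x^k-1)} \] when $n,k,n-k\ge 0$ (a polynomial in $x$ with integer coefficients, equal to $1$ when $k=0$), and $\genfrac{[}{]}{0pt}{}{n}{k}=0$ if any of $n,k,n-k$ is negative. An empty sum is $0$. The limits of summation simply indicate the non-vanishing terms; equivalently $\lambda$ may range over all integers. *)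

(* Defs.v *)
From HB Require Import structures.
From mathcomp Require Import all_boot all_order all_algebra.
From mathcomp Require Import zify ring lra.

Set Implicit Arguments.
Unset Strict Implicit.
Unset Printing Implicit Defensive.

Import Order.TTheory GRing.Theory Num.Theory.
Local Open Scope ring_scope.

Definition gauss_num (n k : nat) : {poly int} :=
  \prod_(i < k) ('X^(n - i) - 1).

Definition gauss_den (k : nat) : {poly int} :=
  \prod_(i < k) ('X^(i.+1) - 1).

(* [%/] is Euclidean division in {poly int}; the divisor is monic and the
   division is exact, see [gaussE]. *)
Definition gauss (n k : int) : {poly int} :=
  if [&& 0 <= n, 0 <= k & 0 <= n - k]
  then gauss_num `|n|%N `|k|%N %/ gauss_den `|k|%N
  else 0.

Lemma gauss_den_monic (k : nat) : gauss_den k \is monic.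
Proof. by apply: monic_prod => i _; apply: monicXnsubC. Qed.

Lemma gauss_numS (n k : nat) :
  gauss_num n.+1 k.+1 = ('X^(n.+1) - 1) * gauss_num n k.
Proof. by rewrite /gauss_num big_ord_recl subn0. Qed.

Lemma gauss_num_exact (n k : nat) :
  exists q : {poly int}, gauss_num n k = q * gauss_den k.
Proof.
elim: n k => [|n IHn] [|k].
- by exists 1; rewrite /gauss_num /gauss_den !big_ord0 mulr1.
- by exists 0; rewrite /gauss_num big_ord_recl expr0 subrr !mul0r.
- by exists 1; rewrite /gauss_num /gauss_den !big_ord0 mulr1.
have [[q1 E1] [q2 E2]] := (IHn k, IHn k.+1).
have [lekn|ltnk] := leqP k n; last first.
  exists 0; rewrite gauss_numS mul0r /gauss_num.
  by rewrite (bigD1 (Ordinal ltnk)) //= subnn expr0 subrr mul0r mulr0.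
exists (q1 + 'X^(k.+1) * q2).
have E3 : gauss_num n k.+1 = gauss_num n k * ('X^(n - k) - 1).
  by rewrite /gauss_num big_ord_recr.
have D : gauss_den k.+1 = gauss_den k * ('X^(k.+1) - 1).
  by rewrite /gauss_den big_ord_recr.
have X : 'X^(n.+1) = 'X^(k.+1) * 'X^(n - k) :> {poly int}.
  by rewrite -exprD addSn subnKC.
rewrite gauss_numS [RHS]mulrDl -[_ * q2 * _]mulrA -E2 E3 D mulrA -E1 X.
ring.
Qed.

Lemma gaussE (n k : nat) : (k <= n)%N ->
  gauss n k * gauss_den k = gauss_num n k.
Proof.
move=> lekn; rewrite /gauss !absz_nat subr_ge0 !lez_nat lekn /=.
have [q ->] := gauss_num_exact n k.
by rewrite Pdiv.IdomainMonic.mulpK // gauss_den_monic.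
Qed.

Definition zrange (m n : int) : seq int :=
  if m <= n then [seq m + i%:Z | i <- iota 0 `|n - m|.+1] else [::].

Lemma mem_zrange (m n l : int) : (l \in zrange m n) = (m <= l <= n).
Proof.
rewrite /zrange; case: ifP => mn; last by rewrite in_nil; lia.
apply/mapP/idP => [[i]|lmn]; first by rewrite mem_iota => + ->; lia.
by exists `|l - m|%N; [rewrite mem_iota; lia | lia].
Qed.

Lemma zrange_uniq (m n : int) : uniq (zrange m n).
Proof.
rewrite /zrange; case: ifP => // _.
by rewrite map_inj_uniq ?iota_uniq // => i j; lia.
Qed.

(* The quotient is exact and nonnegative: see [aexpE] and [aexp_ge0]. *)
Definition aexp (l : int) : int := ((5 * l ^+ 2 - l) %/ 2)%Z.

Lemma aexpE (l : int) : aexp l * 2 = 5 * l ^+ 2 - l.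
Proof.
apply: divzK; rewrite expr2.
have [j [->|->]] : exists j : int, l = 2 * j \/ l = 2 * j + 1.
  by exists (l %/ 2)%Z; lia.
- by apply/dvdzP; exists (10 * j * j - j); ring.
- by apply/dvdzP; exists (10 * j * j + 9 * j + 2); ring.
Qed.

Lemma aexp_ge0 (l : int) : 0 <= aexp l.
Proof. have := aexpE l; rewrite expr2; nia. Qed.

(* [(_ %/ d)%Z] rounds down for d > 0, negative dividends included.  [P n] is
   meant for n >= -1 only. *)
Definition P (n : int) : {poly int} :=
  \sum_(l <- zrange (- (n %/ 5)%Z) ((n + 1) %/ 5)%Z)
    (-1) ^ l * 'X^`|aexp l|%N * gauss n ((n + 5 * l) %/ 2)%Z.

(* Main.v *)
Require Import Defs.
From HB Require Import structures.
From mathcomp Require Import all_boot all_order all_algebra.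
From mathcomp Require Import zify ring.

Set Implicit Arguments.
Unset Strict Implicit.
Unset Printing Implicit Defensive.

Import Order.TTheory GRing.Theory Num.Theory.
Local Open Scope ring_scope.

(** The idea is Schur's. Write [n, k] for the Gaussian binomial and t(n, l) for
    the l-th summand of P(n), whose lower index is k = floor((n + 5 l) / 2).
    Expand [n, k] by two steps of the two q-Pascal rules. For each l the rules
    are chosen by the parity of n + 5 l, so that t(n - 1, l) and
    x^(n-1) t(n - 2, l) split off. The part left over is
    (-1)^l x^(a(l) + k) [n - 2, k] when n + 5 l is even, and
    (-1)^l x^(a(l) + n - k) [n - 2, k - 2] when it is odd. Since
    a(l) - a(l - 1) = 5 l - 3, the odd leftover at l is the opposite of the even
    leftover at l - 1. So, if g(l) is the even leftover, extended by 0 to the l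
    with n + 5 l odd, then for every integer l ([schur_term_rec])
      t(n, l) = t(n - 1, l) + x^(n-1) t(n - 2, l) + (g(l) - g(l - 1)).
    The summands vanish outside the range of summation, so the three sums can be
    taken over one common interval ([P_widen]); there the differences of g
    telescope to boundary values, which are 0.

    The second Pascal step goes down to n - 2 and requires n - 2 >= 0, so n = 1
    is computed directly. Exponents are absolute values of integers: wherever
    such an integer is negative, the Gaussian binomial next to it is 0. *)

(** * Gaussian binomials *)

Lemma gauss_out (n k : int) : ~~ (0 <= k <= n) -> gauss n k = 0.
Proof. by rewrite /gauss => kn; case: ifP => // H; exfalso; lia. Qed.

Lemma gauss_num_recr (n k : nat) :
  gauss_num n k.+1 = gauss_num n k * ('X^(n - k) - 1).
Proof. by rewrite /gauss_num big_ord_recr. Qed.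

Lemma gauss_den_recr (k : nat) :
  gauss_den k.+1 = gauss_den k * ('X^(k.+1) - 1).
Proof. by rewrite /gauss_den big_ord_recr. Qed.

(** For k > n the numerator contains the factor 'X^0 - 1, so the quotient
    formula holds there too; the Pascal rules below then need no separate case
    k = n. *)
Lemma gauss_mul_den (n k : nat) : gauss n k * gauss_den k = gauss_num n k.
Proof.
have [/gaussE //|ltnk] := leqP k n.
rewrite gauss_out ?mul0r; last by lia.
by rewrite /gauss_num (bigD1 (Ordinal ltnk)) //= subnn expr0 subrr mul0r.
Qed.

Lemma gauss_n0 (n : int) : 0 <= n -> gauss n 0 = 1.
Proof.
case: n => // n _; have := gauss_mul_den n 0.
by rewrite /gauss_num /gauss_den !big_ord0 mulr1.
Qed.

Lemma gauss_den_inj (k : nat) (p q : {poly int}) :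
  p * gauss_den k = q * gauss_den k -> p = q.
Proof. by apply: mulIf; exact: monic_neq0 (gauss_den_monic k). Qed.

Lemma gauss_pascal_nat (n k : nat) : (k <= n)%N ->
  gauss n.+1 k.+1 = gauss n k + 'X^(k.+1) * gauss n k.+1 /\
  gauss n.+1 k.+1 = gauss n k.+1 + 'X^(n - k) * gauss n k.
Proof.
move=> lekn.
have XE : 'X^(n.+1) = 'X^(k.+1) * 'X^(n - k) :> {poly int}.
  by rewrite -exprD addSn subnKC.
have E1 : gauss n k * gauss_den k.+1 = gauss_num n k * ('X^(k.+1) - 1).
  by rewrite gauss_den_recr mulrA gauss_mul_den.
by split; apply: (@gauss_den_inj k.+1); rewrite gauss_mul_den gauss_numS
  [RHS]mulrDl -mulrA E1 gauss_mul_den gauss_num_recr XE; ring.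
Qed.

Lemma gauss_pascal_l (n k : int) : 1 <= n ->
  gauss n k = gauss (n - 1) (k - 1) + 'X^`|k|%N * gauss (n - 1) k.
Proof.
move=> n1; have [kn|kn] := boolP (0 <= k <= n); last first.
  by rewrite !gauss_out ?mulr0 ?addr0 //; lia.
have [->|k0] := eqVneq k 0.
  by rewrite (@gauss_out _ (0 - 1)) // !gauss_n0 ?expr0; [ring | lia | lia].
have [[m nE] [j kE]] : (exists m : nat, n = m.+1) /\ (exists j : nat, k = j.+1).
  by split; [exists `|n - 1|%N | exists `|k - 1|%N]; lia.
have -> : n - 1 = m by lia.
have -> : k - 1 = j by lia.
rewrite nE kE absz_nat; apply: (proj1 (gauss_pascal_nat _)); lia.
Qed.

Lemma gauss_pascal_r (n k : int) : 1 <= n ->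
  gauss n k = gauss (n - 1) k + 'X^`|n - k|%N * gauss (n - 1) (k - 1).
Proof.
move=> n1; have [kn|kn] := boolP (0 <= k <= n); last first.
  by rewrite !gauss_out ?mulr0 ?addr0 //; lia.
have [->|k0] := eqVneq k 0.
  by rewrite (@gauss_out _ (0 - 1)) // !gauss_n0 ?mulr0 ?addr0 //; lia.
have [[m nE] [j kE]] : (exists m : nat, n = m.+1) /\ (exists j : nat, k = j.+1).
  by split; [exists `|n - 1|%N | exists `|k - 1|%N]; lia.
have -> : n - 1 = m by lia.
have -> : k - 1 = j by lia.
have -> : `|n - k|%N = (m - j)%N by lia.
rewrite nE kE; apply: (proj2 (gauss_pascal_nat _)); lia.
Qed.

(** * The recurrence for a single summand *)

Definition schur_term (n l : int) : {poly int} :=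
  (-1) ^ l * 'X^`|aexp l|%N * gauss n ((n + 5 * l) %/ 2)%Z.

(** The leftover g(l) of the two Pascal steps. *)
Definition schur_rest (n l : int) : {poly int} :=
  if (2 %| n + 5 * l)%Z then
    (-1) ^ l * 'X^`|aexp l|%N * 'X^`|((n + 5 * l) %/ 2)%Z|%N
      * gauss (n - 2) ((n + 5 * l) %/ 2)%Z
  else 0.

(** Equality of exponents is only required where the Gaussian binomial is
    nonzero, and there the absolute values are harmless. *)
Lemma gauss_expr_congr (n k : int) (i j : nat) :
  (0 <= k <= n -> i = j) -> 'X^i * gauss n k = 'X^j * gauss n k.
Proof.
move=> ij; have [/ij -> //|kn] := boolP (0 <= k <= n).
by rewrite gauss_out // !mulr0.
Qed.

Lemma sign_pred (l : int) : (-1) ^ (l - 1) = - (-1) ^ l :> {poly int}.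
Proof. by rewrite exprzDr ?unitrN1 // exprN1 invrN1 mulrN1. Qed.

Lemma schur_term_rec (n l : int) : 2 <= n ->
  schur_term n l = schur_term (n - 1) l + 'X^`|n - 1|%N * schur_term (n - 2) l
                   + (schur_rest n l - schur_rest n (l - 1)).
Proof.
move=> n2; rewrite /schur_term /schur_rest sign_pred.
have a0 := aexp_ge0 l; have a1 := aexp_ge0 (l - 1).
have aE : aexp l - aexp (l - 1) = 5 * l - 3.
  have := aexpE l; have := aexpE (l - 1); rewrite !expr2; lia.
have [k [lE|lE]] : exists k : int, n + 5 * l = 2 * k \/ n + 5 * l = 2 * k + 1.
  by exists ((n + 5 * l) %/ 2)%Z; lia.
- have -> : (2 %| n + 5 * l)%Z by lia.
  have -> : (2 %| n + 5 * (l - 1))%Z = false by lia.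
  have -> : ((n + 5 * l) %/ 2)%Z = k by lia.
  have -> : ((n - 1 + 5 * l) %/ 2)%Z = k - 1 by lia.
  have -> : ((n - 2 + 5 * l) %/ 2)%Z = k - 1 by lia.
  rewrite (@gauss_pascal_l n k) ?(@gauss_pascal_r (n - 1) k); [|lia..].
  have -> : n - 1 - 1 = n - 2 by lia.
  have E : 'X^(`|k| + `|(n - 1 - k)%R|)%N * gauss (n - 2) (k - 1)
           = 'X^`|n - 1|%N * gauss (n - 2) (k - 1).
    by apply: gauss_expr_congr; lia.
  by rewrite exprD in E; ring: E.
- have -> : (2 %| n + 5 * l)%Z = false by lia.
  have -> : (2 %| n + 5 * (l - 1))%Z by lia.
  have -> : ((n + 5 * l) %/ 2)%Z = k by lia.
  have -> : ((n - 1 + 5 * l) %/ 2)%Z = k by lia.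
  have -> : ((n - 2 + 5 * l) %/ 2)%Z = k - 1 by lia.
  have -> : ((n + 5 * (l - 1)) %/ 2)%Z = k - 2 by lia.
  rewrite (@gauss_pascal_r n k) ?(@gauss_pascal_l (n - 1) (k - 1)); [|lia..].
  have -> : n - 1 - 1 = n - 2 by lia.
  have -> : k - 1 - 1 = k - 2 by lia.
  have E : 'X^(`|n - k| + `|k - 1|)%N * gauss (n - 2) (k - 1)
           = 'X^`|n - 1|%N * gauss (n - 2) (k - 1).
    by apply: gauss_expr_congr; lia.
  (* The odd leftover at l against the even one at l - 1; the exponents agree
     by aE. *)
  have F : 'X^(`|aexp (l - 1)%R| + `|k - 2|)%N * gauss (n - 2) (k - 2)
           = 'X^(`|aexp l| + `|n - k|)%N * gauss (n - 2) (k - 2).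
    by apply: gauss_expr_congr; lia.
  by rewrite !exprD in E F; ring: E F.
Qed.

(** * Summation *)

Lemma telescope_zrange (V : zmodType) (g : int -> V) (m M : int) : m <= M ->
  \sum_(l <- zrange m M) (g l - g (l - 1)) = g M - g (m - 1).
Proof.
move=> mM; rewrite /zrange mM big_map -[iota 0 _]/(index_iota 0 `|M - m|.+1).
rewrite (@telescope_sumr_eq _ 0 _ (fun i : nat => g (m + i%:Z - 1))) //.
  by congr (g _ - g _); lia.
by move=> i _; congr (g _ - g _); lia.
Qed.

Lemma P_widen (n m M : int) : -1 <= n ->
  m <= - (n %/ 5)%Z -> ((n + 1) %/ 5)%Z <= M ->
  P n = \sum_(l <- zrange m M) schur_term n l.
Proof.
move=> n1 hm hM.
set r := zrange (- (n %/ 5)%Z) ((n + 1) %/ 5)%Z.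
rewrite [RHS](bigID (mem r)) /= [X in _ + X]big1 ?addr0; last first.
  move=> l; rewrite mem_zrange => lr.
  by rewrite /schur_term gauss_out ?mulr0 //; lia.
rewrite -[RHS]big_filter; apply: perm_big; apply: uniq_perm.
- exact: zrange_uniq.
- by rewrite filter_uniq // zrange_uniq.
by move=> l; rewrite mem_filter !mem_zrange; lia.
Qed.

Lemma P_small (n : int) : 0 <= n <= 1 -> P n = 1.
Proof.
move=> n01; rewrite (@P_widen n 0 0); [|lia..].
rewrite /zrange /= big_cons big_nil addr0 /schur_term.
have -> : ((n + 5 * (0 + 0%:Z)) %/ 2)%Z = 0 by lia.
by rewrite gauss_n0 ?mulr1 //; lia.
Qed.

Lemma P_m1 : P (-1) = 0.
Proof. by rewrite /P /zrange big_nil. Qed.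

Theorem proposition4 :
  [/\ P (-1) = 0,
      P 0 = 1 &
      forall n : int, 1 <= n ->
        P n = P (n - 1) + 'X^`|n - 1|%N * P (n - 2)].
Proof.
split=> [||n n1]; [exact: P_m1 | exact: P_small |].
have [->|n_neq1] := eqVneq n 1.
  have -> : 1 - 2 = -1 :> int by [].
  by rewrite P_m1 !P_small // mulr0 addr0.
(* The interval [-n, n] contains the three ranges of summation, and [schur_rest]
   is 0 at the arguments n and - n - 1 left by the telescoping. *)
rewrite !(@P_widen _ (- n) n); [|lia..].
rewrite mulr_sumr -big_split /=.
rewrite (eq_bigr _ (fun l _ => @schur_term_rec n l _)); last by lia.
rewrite big_split /= telescope_zrange; last by lia.
have rest0 l : 0 < n -> (l <= - n) || (n <= l) -> schur_rest n l = 0.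
  move=> n0 hl; rewrite /schur_rest; case: ifP => // _.
  by rewrite gauss_out ?mulr0 //; lia.
by rewrite !rest0 ?subrr ?addr0 //; lia.
Qed.
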